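(* Let $E$ be an $n$-dimensional vector space over a field $\mathbb{F}$, and let $(E,\mathcal{B})$ be a $q$-matroid given by its collection of bases, i.e. $\mathcal{B}\subseteq\mathcal{L}(E)$ satisfies (B1), (B2), (B3) and (B4). Then $\mathcal{B}$ satisfies the axiom (nB3) For all $B_1,B_2\in\mathcal{B}$, and for each subspace $A$ that has codimension $1$ in $B_1$, there exists $X\subseteq E$ of codimension $1$ in $E$ such that $X\supseteq A$, $X\not\supseteq B_2$ and $A+x\in\mathcal{B}$ for all $1$-dimensional $x\subseteq E$, $x\not\subseteq X$.
   Context: $n$ is a positive integer, $\mathbb{F}$ is an arbitrary field, and $\mathcal{L}(E)$ denotes the lattice of all subspaces of $E$. For a family $\mathcal{A}\subseteq\mathcal{L}(E)$ and $X\in\mathcal{L}(E)$, $\max(X,\mathcal{A})$ is the set of members of $\mathcal{A}$ contained in $X$ that have the largest dimension among all members of $\mathcal{A}$ contained in $X$, and $X\cap\mathcal{A}:=\{X\cap A: A\in\mathcal{A}\}$. (So $\max(E,A\cap\mathcal{B})$ is the set of intersections $A\cap B$, $B\in\mathcal{B}$, of maximal dimension.) Basis axioms for $\mathcal{B}\subseteq\mathcal{L}(E)$: (B1) $\mathcal{B}\neq\emptyset$. (B2) For all $B_1,B_2\in\mathcal{B}$, if $B_1\subseteq B_2$, then $B_1=B_2$. (B3) For all $B_1,B_2\in\mathcal{B}$ and for every subspace $A$ of codimension $1$ in $B_1$ satisfying $B_1\cap B_2\subseteq A$, there is a $1$-dimensional subspace $y$ of $B_2$ such that $A+y\in\mathcal{B}$.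 (B4) For all $A,B\in\mathcal{L}(E)$ and $I,J\in\mathcal{L}(E)$ such that $I\in\max(E,A\cap\mathcal{B})$ and $J\in\max(E,B\cap\mathcal{B})$, there exists $K\in\max(E,(A+B)\cap\mathcal{B})$ such that $K\subseteq I+J$. *)

(* Defs.v *)
From mathcomp Require Import all_boot all_order all_algebra.
From mathcomp Require Import boolp classical_sets.

Set Implicit Arguments.
Unset Strict Implicit.
Unset Printing Implicit Defensive.

Local Open Scope classical_set_scope.

Section QMatroidBases.
Variables (F : fieldType) (E : vectType F).
Implicit Types (A B I J K X Y x y : {vspace E}) (S : set {vspace E}).

Definition has_codim1 A Y : Prop := (A <= Y)%VS /\ \dim Y = (\dim A).+1.

Definition max_in X S : set {vspace E} :=
  [set A | [/\ S A, (A <= X)%VS &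
             forall A', S A' -> (A' <= X)%VS -> \dim A' <= \dim A]].

Definition cap_family X S : set {vspace E} := [set (X :&: A)%VS | A in S].

Definition axiom_B1 S : Prop := S <> set0.

Definition axiom_B2 S : Prop :=
  forall B1 B2, S B1 -> S B2 -> (B1 <= B2)%VS -> B1 = B2.

Definition axiom_B3 S : Prop :=
  forall B1 B2, S B1 -> S B2 ->
  forall A, has_codim1 A B1 -> (B1 :&: B2 <= A)%VS ->
  exists y, [/\ \dim y = 1, (y <= B2)%VS & S (A + y)%VS].

Definition axiom_B4 S : Prop :=
  forall A B I J,
  max_in fullv (cap_family A S) I ->
  max_in fullv (cap_family B S) J ->
  exists2 K, max_in fullv (cap_family (A + B)%VS S) K & (K <= I + J)%VS.

Definition q_matroid_bases S : Prop :=
  [/\ axiom_B1 S, axiom_B2 S, axiom_B3 S & axiom_B4 S].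

Definition axiom_nB3 S : Prop :=
  forall B1 B2, S B1 -> S B2 ->
  forall A, has_codim1 A B1 ->
  exists X, [/\ has_codim1 X fullv, (A <= X)%VS, ~ (B2 <= X)%VS &
    forall x, \dim x = 1 -> ~ (x <= X)%VS -> S (A + x)%VS].

End QMatroidBases.

(* Main.v *)
Require Import Defs.
From mathcomp Require Import all_boot all_order all_algebra.
From mathcomp Require Import boolp classical_sets.

(** The hyperplane [X] is found above the closure of [A] in the q-matroid.

    All bases have the same dimension [r] ([bases_equidim]): by (B3) one can
    trade, one dimension at a time, a part of [B1] outside [B2] for a part of
    [B2], keeping the dimension of the basis, until [B2] is reached.

    Let [A] have codimension 1 in the basis [B1].  Say that [A] spans [Y] if
    [Y] contains [A] and has no intersection with a basis of dimension larger
    than [\dim A], that is, if [Y] contains [A] and has the same rank.  Axiom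
    (B4) with [I = J = A] says that the sum of two subspaces spanned by [A] is
    again spanned by [A] ([spans_sum]), so there is a largest one, the closure
    [C] of [A] ([closure_exists]).  Its rank is [r - 1], hence [C] does not
    contain [B2], and some hyperplane [X] above [C] does not contain [B2] either
    ([hyperplane_avoiding]).  If a line [x] is not in [X], then [A + x] is not
    in [C], so it is not spanned by [A]; some basis therefore meets [A + x] in
    dimension [r], and as [\dim (A + x) <= r] that basis is [A + x] itself. *)

Set Implicit Arguments.
Unset Strict Implicit.
Unset Printing Implicit Defensive.

Section Subspaces.
Variables (F : fieldType) (E : vectType F).
Implicit Types (U V W X Y Z : {vspace E}).

Lemma exists_max_dim (P : {vspace E} -> Prop) Y0 :
  P Y0 -> exists2 Y, P Y & forall Z, P Z -> \dim Z <= \dim Y.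
Proof.
move=> PY0; pose Q m := `[< exists2 Y, P Y & \dim Y = m >].
have exQ : exists m, Q m by exists (\dim Y0); apply/asboolP; exists Y0.
have boundQ m : Q m -> m <= \dim (fullv : {vspace E}).
  by case/asboolP=> Y _ <-; apply/dimvS/subvf.
case: (ex_maxnP exQ boundQ) => m /asboolP[Y PY dimY] maxm.
by exists Y => // Z PZ; rewrite dimY; apply/maxm/asboolP; exists Z.
Qed.

Lemma eq_of_sub_dim U V : (U <= V)%VS -> \dim V <= \dim U -> U = V.
Proof. by move=> sUV leVU; apply/eqP; rewrite eqEdim sUV leVU. Qed.

Lemma dim_add_line_le U x : \dim x = 1 -> \dim (U + x)%VS <= (\dim U).+1.
Proof. by move=> dx; rewrite -addn1 -dx; apply: (dimv_add_leqif U x).1. Qed.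

Lemma dim_add_line_sub U x :
  \dim x = 1 -> ~ (x <= U)%VS -> \dim (U + x)%VS = (\dim U).+1.
Proof.
move=> dx nxU; apply/eqP; rewrite eqn_leq dim_add_line_le //=.
rewrite ltnNge; apply/negP=> le; apply: nxU.
by rewrite (eq_of_sub_dim (addvSl U x) le) addvSr.
Qed.

Lemma dim_add_vector U (v : E) :
  v \notin U -> \dim (U + <[v]>)%VS = (\dim U).+1.
Proof.
move=> vU; apply: dim_add_line_sub; last by rewrite -memvE; apply/negP.
by rewrite dim_vline; case: eqP vU => // ->; rewrite mem0v.
Qed.

(** Let [v] be a vector of [V] outside [U] and [W] a complement of [U + <[v]>].
    The whole space is the direct sum of [U], [<[v]>] and [W]; leaving out the
    line of [v] gives the hyperplane [U + W], which misses [v]. *)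
Lemma hyperplane_avoiding U V :
  ~ (V <= U)%VS -> exists X, [/\ has_codim1 X fullv, (U <= X)%VS & ~ (V <= X)%VS].
Proof.
move/negP/subvPn=> [v vV vU].
have addvE : ((U + (U + <[v]>)^C) + <[v]> = fullv)%VS.
  by rewrite -addvA [((_)^C + _)%VS]addvC addvA addv_complf.
have dimX : \dim (fullv : {vspace E}) = (\dim (U + (U + <[v]>)^C)%VS).+1.
  rewrite dimv_disjoint_sum.
    rewrite -addSn -(dim_add_vector vU) -(addv_complf (U + <[v]>)%VS).
    by rewrite dimv_disjoint_sum // capv_compl.
  apply/eqP; rewrite -subv0 -(capv_compl (U + <[v]>)%VS).
  by apply: capvS => //; apply: addvSl.
exists (U + (U + <[v]>)^C)%VS; split; first by split; rewrite ?subvf.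
  exact: addvSl.
move=> /subvP/(_ v vV) vX; move: dimX; rewrite -addvE.
have /addv_idPl -> : (<[v]> <= U + (U + <[v]>)^C)%VS by rewrite -memvE.
by move/eqP; rewrite ltn_eqF.
Qed.

(** Intersecting [V] with a hyperplane above [U] that does not contain [V] lowers
    its dimension by exactly 1. *)
Lemma codim1_between U V :
  (U <= V)%VS -> U <> V -> exists2 A, has_codim1 A V & (U <= A)%VS.
Proof.
move=> sUV neUV.
have nsVU : ~ (V <= U)%VS.
  by move=> sVU; apply: neUV; apply/eqP; rewrite eqEsubv sUV.
have [X [[_ dimX] sUX nsVX]] := hyperplane_avoiding nsVU.
exists (V :&: X)%VS; last by rewrite subv_cap sUV.
split; first exact: capvSl.
have ltX : \dim X < \dim (X + V)%VS.
  rewrite ltnNge; apply/negP=> le; apply: nsVX.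
  by rewrite (eq_of_sub_dim (addvSl X V) le) addvSr.
have : \dim (X + V)%VS <= (\dim X).+1 by rewrite -dimX; apply/dimvS/subvf.
have := dimv_sum_cap X V; rewrite capvC => dimE leX.
have dimXV : \dim (X + V)%VS = (\dim X).+1 by apply/eqP; rewrite eqn_leq leX.
by apply: (@addnI (\dim X)); rewrite -dimE dimXV addSnnS.
Qed.

End Subspaces.

Section Bases.
Variables (F : fieldType) (E : vectType F) (S : set {vspace E}).
Implicit Types (A B C X Y Z : {vspace E}).

(** Each exchange step of (B3) keeps the dimension of [B1], as (B2) forbids that
    the new line lies in [A], and strictly enlarges the intersection with
    [B2]; hence the induction on the codimension of [B1 :&: B2] in [B2]. *)
Lemma bases_equidim B1 B2 :
  axiom_B2 S -> axiom_B3 S -> S B1 -> S B2 -> \dim B1 = \dim B2.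
Proof.
move=> ax2 ax3 SB1 SB2.
have [k] := ubnP (\dim B2 - \dim (B1 :&: B2)%VS).
elim: k B1 SB1 => // k IHk B1 SB1 ltk.
have [-> // | /eqP neB] := eqVneq B1 B2.
have neI : (B1 :&: B2)%VS <> B1.
  by move=> eqI; apply: neB; apply: ax2 => //; rewrite -eqI capvSr.
have [A [sAB1 dimB1] sIA] := codim1_between (capvSl B1 B2) neI.
have [y [dy syB2 SAy]] := ax3 _ _ SB1 SB2 _ (conj sAB1 dimB1) sIA.
have nsyB1 : ~ (y <= B1)%VS.
  move=> syB1; have syA : (y <= A)%VS.
    by apply: subv_trans sIA; rewrite subv_cap syB1.
  have SA : S A by move: SAy; rewrite (addv_idPl syA).
  by move: dimB1; rewrite -(ax2 _ _ SA SB1 sAB1) => /eqP; rewrite ltn_eqF.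
have nsyA : ~ (y <= A)%VS by move=> /subv_trans/(_ sAB1).
rewrite dimB1 -(dim_add_line_sub dy nsyA); apply: IHk => //.
have ltI : \dim (B1 :&: B2)%VS < \dim ((A + y) :&: B2)%VS.
  have nsyI : ~ (y <= B1 :&: B2)%VS by rewrite subv_cap => /andP[].
  rewrite -(dim_add_line_sub dy nsyI); apply: dimvS.
  by rewrite subv_cap addvS // subv_add capvSr.
apply: leq_trans (_ : _ < _) _; last by rewrite -ltnS; exact: ltk.
by rewrite ltn_sub2l // (leq_trans ltI) // dimvS // capvSr.
Qed.

(** [Y] contains [A] and has rank at most [\dim A], the rank of a subspace being
    the largest dimension of its intersections with the members of [S]; when
    [A] lies in a basis, this says that [Y] lies in the closure of [A]. *)
Definition spans A Y : Prop :=
  (A <= Y)%VS /\ forall B, S B -> \dim (Y :&: B)%VS <= \dim A.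

Lemma spans_refl A : spans A A.
Proof. by split=> // B _; apply/dimvS/capvSl. Qed.

(** An intersection of [Y] with a basis above [A] contains [A], so it is [A]. *)
Lemma spans_max_in A B Y :
  S B -> (A <= B)%VS -> spans A Y -> max_in fullv (cap_family Y S) A.
Proof.
move=> SB sAB [sAY leA]; split; rewrite ?subvf //.
  exists B => //; apply/esym/eq_of_sub_dim; last exact: leA.
  by rewrite subv_cap sAY.
by move=> _ [B' SB' <-] _; apply: leA.
Qed.

(** (B4) provides a maximal intersection of [Y + Z] with a basis inside
    [A + A = A], which bounds the rank of [Y + Z]. *)
Lemma spans_sum A B Y Z :
  axiom_B4 S -> S B -> (A <= B)%VS ->
  spans A Y -> spans A Z -> spans A (Y + Z)%VS.
Proof.
move=> ax4 SB sAB spY spZ.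
have [K [_ _ maxK] sKA] :=
  ax4 _ _ _ _ (spans_max_in SB sAB spY) (spans_max_in SB sAB spZ).
split; first exact: subv_trans spY.1 (addvSl Y Z).
move=> B' SB'; apply: leq_trans (_ : \dim K <= _).
  by apply: maxK; rewrite ?subvf //; exists B'.
by apply: dimvS; rewrite addvv in sKA.
Qed.

Lemma closure_exists A B :
  axiom_B4 S -> S B -> (A <= B)%VS ->
  exists2 C, spans A C & forall Y, spans A Y -> (Y <= C)%VS.
Proof.
move=> ax4 SB sAB.
have [C spC maxC] := exists_max_dim (spans_refl A).
exists C => // Y spY.
have leC := maxC _ (spans_sum ax4 SB sAB spC spY).
by rewrite (eq_of_sub_dim (addvSl C Y) leC) addvSr.
Qed.

End Bases.

Theorem theorem28 (n : nat) (n_gt0 : 0 < n) (F : fieldType) (E : vectType F)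
    (dimE : \dim (fullv : {vspace E}) = n) (B : set {vspace E}) :
  q_matroid_bases B -> axiom_nB3 B.
Proof.
move=> [_ ax2 ax3 ax4] B1 B2 SB1 SB2 A [sAB1 dimB1].
have equidim B' : B B' -> \dim B' = (\dim A).+1.
  by move=> SB'; rewrite -dimB1; apply: (bases_equidim ax2 ax3).
have [C [sAC leC] maxC] := closure_exists ax4 SB1 sAB1.
have nsB2C : ~ (B2 <= C)%VS.
  by move=> /capv_idPr eqB2; have := leC _ SB2; rewrite eqB2 equidim // ltnn.
have [X [codimX sCX nsB2X]] := hyperplane_avoiding nsB2C.
exists X; split=> //; first exact: subv_trans sCX.
move=> x dx nsxX; apply: contrapT => nSAx; apply: nsxX.
apply: subv_trans (addvSr A x) (subv_trans (maxC _ _) sCX).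
split=> [|B' SB']; first exact: addvSl.
rewrite leqNgt; apply/negP=> ltA; apply: nSAx.
(* The intersection has dimension at least that of both A + x and B'. *)
suff -> : (A + x)%VS = B' by [].
rewrite -(eq_of_sub_dim (capvSl (A + x)%VS B')).
  by apply: eq_of_sub_dim; rewrite ?capvSr // equidim.
exact: leq_trans (dim_add_line_le A dx) ltA.
Qed.
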